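(* Let $P$ and $Q$ be probability distributions on $\mathsf Z$, and let $a_P,a_Q\in\mathsf A$ satisfy $H_\ell(P)=\mathbb E_P[\ell(Z,a_P)]$ and $H_\ell(Q)=\mathbb E_Q[\ell(Z,a_Q)]$. For $a\in\mathsf A$ let $P_{\ell(Z,a)}$ and $Q_{\ell(Z,a)}$ be the distributions on $\mathbb R$ of $\ell(Z,a)$ when $Z\sim P$ and when $Z\sim Q$, respectively. Then $$H_\ell(P)-H_\ell(Q)\le\mathcal W_{|\cdot|}\big(P_{\ell(Z,a_Q)},Q_{\ell(Z,a_Q)}\big)$$ and $$H_\ell(Q)-H_\ell(P)\le\mathcal W_{|\cdot|}\big(P_{\ell(Z,a_P)},Q_{\ell(Z,a_P)}\big).$$
   Context: $\mathsf Z$ is a (measurable) space of outcomes, $\mathsf A$ a space of actions, $\ell:\mathsf Z\times\mathsf A\to\mathbb R$ a loss function. The generalized entropy of a distribution $P$ on $\mathsf Z$ is $H_\ell(P)=\inf_{a\in\mathsf A}\mathbb E_P[\ell(Z,a)]$, $Z\sim P$. It is assumed that the infimum is attained for the distributions considered and that the expectations involved are well defined. For distributions $\mu,\nu$ on $\mathbb R$, $\mathcal W_{|\cdot|}(\mu,\nu)=\inf\mathbb E[|U-V|]$, the infimum being over joint distributions of $(U,V)$ with marginals $\mu$ and $\nu$. *)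

(* Defs.v *)
From HB Require Import structures.
From mathcomp Require Import all_boot all_order all_algebra.
From mathcomp Require Import all_classical all_reals all_analysis.

Set Implicit Arguments.
Unset Strict Implicit.
Unset Printing Implicit Defensive.

Import Order.TTheory GRing.Theory Num.Theory.

Local Open Scope classical_set_scope.
Local Open Scope ring_scope.
Local Open Scope ereal_scope.

(* The expectation of [X] has a meaning in [-oo, +oo].  This is a separate
   condition because the library's integral is total: it returns -oo when both
   the positive and the negative part of [X] have infinite expectation. *)
Definition expectation_defined {d : measure_display} {Z : measurableType d}
    {R : realType} (P : probability Z R) (X : Z -> R) : Prop :=
  'E_P[(X ^\+)%R] < +oo \/ 'E_P[(X ^\-)%R] < +oo.

Definition entropy {d : measure_display} {Z : measurableType d} {R : realType}
    {A : Type} (l : Z -> A -> R) (P : probability Z R) : \bar R :=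
  ereal_inf [set 'E_P[l^~ a] | a in [set: A]].

Section loss_distribution.
Context {d : measure_display} {Z : measurableType d} {R : realType} {A : Type}.
Variables (l : Z -> A -> R) (ml : forall a, measurable_fun [set: Z] (l^~ a)).

Definition loss_rv (a : A) : {mfun Z >-> R} := mfun_Sub (mem_set (ml a)).

Definition loss_distribution (P : probability Z R) (a : A) : probability R R :=
  distribution P (loss_rv a).

End loss_distribution.

(* The marginals are compared on measurable sets only, since the values of a
   library measure on non-measurable sets carry no information. *)
Definition couplings {R : realType} (mu nu : probability R R) :
    set (probability (R * R)%type R) :=
  [set pi : probability (R * R)%type R | forall B : set R, measurable B ->
     pushforward pi fst B = mu B /\ pushforward pi snd B = nu B].

Definition wasserstein {R : realType} (mu nu : probability R R) : \bar R :=
  ereal_inf [set 'E_pi[fun x : R * R => `|x.1 - x.2|%R] | pi in couplings mu nu].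

(* Main.v *)
(** Nonnegative integrals only see the marginals of a coupling [pi], so that
    integrating the pointwise bound [x^+ + y^- <= x^- + y^+ + |x - y|] against
    [pi] compares positive and negative parts separately; no difference is
    formed until the end, and infinite expectations need no special treatment
    before that point. The two inequalities then follow from the fact that
    the entropy is at most the expected loss of any action. *)

Require Import Defs.
From HB Require Import structures.
From mathcomp Require Import all_boot all_order all_algebra.
From mathcomp Require Import all_classical all_reals all_analysis.
From mathcomp Require Import measurable_realfun lra.

Set Implicit Arguments.
Unset Strict Implicit.
Unset Printing Implicit Defensive.

Import Order.TTheory GRing.Theory Num.Theory.

Local Open Scope classical_set_scope.
Local Open Scope ring_scope.
Local Open Scope ereal_scope.

Lemma expectation_pos_neg {d : measure_display} {Z : measurableType d}
    {R : realType} (P : probability Z R) (X : Z -> R) :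
  'E_P[X] = 'E_P[(X ^\+)%R] - 'E_P[(X ^\-)%R].
Proof.
rewrite unlock integralE; congr (_ - _); apply: eq_integral => z _.
- by rewrite funeposE /= /funrpos EFin_max.
- by rewrite funenegE /= /funrneg EFin_max.
Qed.

(* Either difference may be infinite; the definedness hypotheses rule out the
   conventional value [+oo - +oo = -oo] inside the parentheses only. *)
Lemma sube_le_of_adde_le {R : realType} (p p' q q' w : \bar R) :
  0 <= p -> 0 <= p' -> 0 <= q -> 0 <= q' -> 0 <= w ->
  p < +oo \/ p' < +oo -> q < +oo \/ q' < +oo ->
  p + q' <= p' + q + w -> (p - p') - (q - q') <= w.
Proof.
move=> p0 p'0 q0 q'0 w0 defp defq.
case: w w0 => [w| |//] w0; last by rewrite leey.
(* Here [w] is finite. If [p'] or [q] is [+oo], definedness makes the left side of the goal [-oo];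
   if [p] or [q'] is [+oo], the hypothesis forces one of these cases or is false. *)
case: p p0 defp => [p| |//] p0 defp; case: p' p'0 defp => [p'| |//] p'0 defp;
  case: q q0 defq => [q| |//] q0 defq; case: q' q'0 defq => [q'| |//] q'0 defq;
  rewrite ?leNye //= ?lee_fin; try by case: defp; case: defq.
by move=> pq; lra.
Qed.

Section transport.
Context {R : realType}.

(** Both sides are integrals of [g] against a law on the line, and agreement of the two laws on
    measurable sets suffices for these. Nonnegativity of [g] keeps both changes of variables valid
    when the value is [+oo]. *)
Lemma ge0_integral_law {d d' : measure_display} {Z : measurableType d}
    {T : measurableType d'} (P : probability Z R) (X : {RV P >-> R})
    (pi : probability T R) (U : T -> R) (g : R -> R) :
  measurable_fun setT U ->
  (forall B, measurable B -> pushforward pi U B = distribution P X B) ->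
  measurable_fun setT g -> (forall x, 0 <= g x)%R ->
  'E_P[g \o X] = \int[pi]_t (g (U t))%:E.
Proof.
move=> mU law mg g0; rewrite unlock.
have mEg : measurable_fun setT (EFin \o g) by exact/measurable_EFinP.
have Eg0 y : 0 <= (EFin \o g) y by rewrite /= lee_fin.
transitivity (\int[distribution P X]_x (EFin \o g) x).
  by rewrite ge0_integral_distribution.
transitivity (\int[pushforward pi U]_x (EFin \o g) x).
  by apply: eq_measure_integral => B mB _; exact/esym/law.
by rewrite (ge0_integral_pushforward mU).
Qed.

(** A general [T] with maps [U] and [V], instead of the plane with its projections in a fixed order,
    lets one coupling be read both ways. *)
Lemma expectationB_le_dist {d1 d2 d : measure_display}
    {Z1 : measurableType d1} {Z2 : measurableType d2} {T : measurableType d}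
    (P : probability Z1 R) (Q : probability Z2 R)
    (X : {RV P >-> R}) (Y : {RV Q >-> R})
    (pi : probability T R) (U V : T -> R) :
  expectation_defined P X -> expectation_defined Q Y ->
  measurable_fun setT U -> measurable_fun setT V ->
  (forall B, measurable B -> pushforward pi U B = distribution P X B) ->
  (forall B, measurable B -> pushforward pi V B = distribution Q Y B) ->
  'E_P[X] - 'E_Q[Y] <= 'E_pi[fun t => `|U t - V t|%R].
Proof.
move=> defX defY mU mV lawU lawV.
have mpos : measurable_fun setT (fun x : R => Num.max x 0)%R.
  by apply: measurable_maxr => //; exact: measurable_cst.
have mneg : measurable_fun setT (fun x : R => Num.max (- x) 0)%R.
  by apply: measurable_maxr; [exact: measurable_funN|exact: measurable_cst].
have pos0 (x : R) : (0 <= Num.max x 0)%R by rewrite le_max lexx orbT.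
have neg0 (x : R) : (0 <= Num.max (- x) 0)%R by rewrite le_max lexx orbT.
have mW : measurable_fun setT (fun t => `|U t - V t|%R).
  by apply: measurableT_comp => //; exact: measurable_funB.
rewrite (expectation_pos_neg P) (expectation_pos_neg Q).
apply: sube_le_of_adde_le; rewrite ?expectation_ge0 //.
rewrite (ge0_integral_law mU lawU mpos) // (ge0_integral_law mV lawV mneg) //.
rewrite (ge0_integral_law mU lawU mneg) // (ge0_integral_law mV lawV mpos) //.
have mE (g : R -> R) (W : T -> R) : measurable_fun setT g ->
    measurable_fun setT W -> measurable_fun setT (fun t => (g (W t))%:E).
  by move=> mg mW'; apply/measurable_EFinP; exact: measurableT_comp mg mW'.
have [mUp mUn mVp mVn] := And4 (mE _ _ mpos mU) (mE _ _ mneg mU)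
  (mE _ _ mpos mV) (mE _ _ mneg mV).
have mWE : measurable_fun setT (fun t => `|U t - V t|%:E).
  exact/measurable_EFinP.
(* Additivity of nonnegative integrals merges each side into one integral over [pi], leaving a
   pointwise comparison. *)
rewrite unlock -!ge0_integralD //=; first last.
all: try by move=> *; rewrite -?EFinD lee_fin ?addr_ge0.
all: try exact: emeasurable_funD.
apply: ge0_le_integral => //=.
all: try by move=> *; rewrite -?EFinD lee_fin ?addr_ge0.
all: try by do ?apply: emeasurable_funD.
move=> t _; rewrite -!EFinD lee_fin.
(* The pointwise bound is [u - v <= |u - v|] rearranged; the sign cases make the maxima linear. *)
have := ler_norm (U t - V t)%R.
have [Ut|Ut] := leP (U t) 0%R; have [Vt|Vt] := leP (V t) 0%R;
  have [nUt|nUt] := leP (- U t)%R 0%R; have [nVt|nVt] := leP (- V t)%R 0%R;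
  lra.
Qed.

Lemma expectationB_le_wasserstein {d1 d2 : measure_display}
    {Z1 : measurableType d1} {Z2 : measurableType d2}
    (P : probability Z1 R) (Q : probability Z2 R)
    (X : {RV P >-> R}) (Y : {RV Q >-> R}) :
  expectation_defined P X -> expectation_defined Q Y ->
  'E_P[X] - 'E_Q[Y] <= wasserstein (distribution P X) (distribution Q Y) /\
  'E_Q[Y] - 'E_P[X] <= wasserstein (distribution P X) (distribution Q Y).
Proof.
move=> defX defY; split; apply: le_ereal_inf_tmp => _ [pi piXY <-].
- apply: (expectationB_le_dist (U := fst) (V := snd)) => // B mB;
    by case: (piXY B mB).
(* Exchanging the projections takes the place of symmetry of [wasserstein]. *)
- have -> : (fun x : R * R => `|x.1 - x.2|)%R = (fun x => `|x.2 - x.1|)%R.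
    by apply/funext => x; rewrite distrC.
  apply: (expectationB_le_dist (U := snd) (V := fst)) => // B mB;
    by case: (piXY B mB).
Qed.

End transport.

Theorem theorem6 (R : realType) (d : measure_display) (Z : measurableType d)
    (A : Type) (l : Z -> A -> R)
    (ml : forall a : A, measurable_fun [set: Z] (l^~ a))
    (P Q : probability Z R)
    (defP : forall a : A, expectation_defined P (l^~ a))
    (defQ : forall a : A, expectation_defined Q (l^~ a))
    (aP aQ : A)
    (optP : entropy l P = 'E_P[l^~ aP])
    (optQ : entropy l Q = 'E_Q[l^~ aQ]) :
  entropy l P - entropy l Q <=
    wasserstein (loss_distribution ml P aQ) (loss_distribution ml Q aQ) /\
  entropy l Q - entropy l P <=
    wasserstein (loss_distribution ml P aP) (loss_distribution ml Q aP).
Proof.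
have entropy_le (S : probability Z R) (a : A) : entropy l S <= 'E_S[l^~ a].
  by apply: ereal_inf_lbound; exists a.
split.
(* The action [aQ] is exact for [Q] and possibly suboptimal for [P], which is the direction
   wanted. *)
- rewrite optQ; apply: le_trans (leeB (entropy_le P aQ) (lexx _)) _.
  exact: (expectationB_le_wasserstein (X := loss_rv ml aQ)
    (Y := loss_rv ml aQ) (defP aQ) (defQ aQ)).1.
- rewrite optP; apply: le_trans (leeB (entropy_le Q aP) (lexx _)) _.
  exact: (expectationB_le_wasserstein (X := loss_rv ml aP)
    (Y := loss_rv ml aP) (defP aP) (defQ aP)).2.
Qed.
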